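(* Let $k\ge 1$ be an integer. Then: (1) $f(P_3^k)=2$; (2) $f(P_m^k)=1$ for every odd integer $m=2n+1\ge 5$; (3) $f(P_m^k)\ge \lceil \sqrt{\beta_n k}\,\rceil$ for every even integer $m=2n\ge 2$, where $\beta_n>0$ is the constant depending only on $n$ given by the minimum positive root of the polynomial $g_n(x)$. In particular, $\beta_1=1$.
   Context: All graphs are simple and finite. For a graph $G$, $\alpha(G)$ is its independence number, $\Delta(G)$ its maximum degree, and $G[S]$ the subgraph induced by $S\subseteq V(G)$. Define $$f(G)=\min\{\Delta(G[S]) : S\subseteq V(G),\ |S|=\alpha(G)+1\}.$$ $P_m$ is the path on $m$ vertices, and $P_m^k=P_m\square\cdots\square P_m$ is the Cartesian product of $k$ copies of $P_m$ (vertices of $G\square H$ are pairs; $(x_1,x_2)$ and $(y_1,y_2)$ are adjacent iff $x_1=y_1$ and $x_2y_2\in E(H)$, or $x_2=y_2$ and $x_1y_1\in E(G)$). The polynomials $g_n$ are defined by $g_0(x)=1$, $g_1(x)=x-1$, and $g_j(x)=(x-2)g_{j-1}(x)-g_{j-2}(x)$ for $j\ge 2$; $\beta_n$ ($n\ge 1$) denotes the minimum positive root of $g_n(x)$. *)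

(* Defs.v *)
From HB Require Import structures.
From mathcomp Require Import all_boot all_order all_algebra.
From mathcomp Require Import boolp classical_sets reals.

Set Implicit Arguments.
Unset Strict Implicit.
Unset Printing Implicit Defensive.

Import Order.TTheory GRing.Theory Num.Theory.

Local Open Scope nat_scope.

Record sgraph := SGraph {
  vertex :> finType;
  edge : rel vertex;
  edge_sym : symmetric edge;
  edge_irr : irreflexive edge
}.

Definition independent (G : sgraph) (S : {set G}) : bool :=
  [forall x in S, forall y in S, ~~ edge x y].

Definition alpha (G : sgraph) : nat :=
  \max_(S : {set G} | independent S) #|S|.

Definition degree (G : sgraph) (x : G) : nat := #|[set y | edge x y]|.

Definition max_degree (G : sgraph) : nat := \max_(x : G) degree x.

Section Induced.
Variables (G : sgraph) (S : {set G}).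

Definition induced_edge : rel {x : G | x \in S} :=
  fun x y => edge (val x) (val y).

Lemma induced_edge_sym : symmetric induced_edge.
Proof. by move=> x y; apply: edge_sym. Qed.

Lemma induced_edge_irr : irreflexive induced_edge.
Proof. by move=> x; apply: edge_irr. Qed.

Definition induced : sgraph := SGraph induced_edge_sym induced_edge_irr.

End Induced.

(* The neutral value #|G| exceeds every maximum degree, so it does not affect
   the minimum as soon as some S has size alpha G + 1, i.e. as soon as G has
   at least one edge; the minimum is undefined for edgeless G. *)
Definition f (G : sgraph) : nat :=
  \big[minn/#|G|]_(S : {set G} | #|S| == (alpha G).+1)
    max_degree (induced S).

Section Path.
Variable m : nat.

Definition path_edge : rel 'I_m :=
  fun i j => (i.+1 == j :> nat) || (j.+1 == i :> nat).

Lemma path_edge_sym : symmetric path_edge.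
Proof. by move=> i j; rewrite /path_edge orbC. Qed.

Lemma path_edge_irr : irreflexive path_edge.
Proof. by move=> i; rewrite /path_edge orbb -[X in _ == X]add0n -add1n eqn_add2r. Qed.

Definition path_graph : sgraph := SGraph path_edge_sym path_edge_irr.

End Path.

Section Product.
Variables G H : sgraph.

Definition cart_edge : rel (G * H)%type :=
  fun x y => ((x.1 == y.1) && edge x.2 y.2) || ((x.2 == y.2) && edge x.1 y.1).

Lemma cart_edge_sym : symmetric cart_edge.
Proof.
by move=> x y; rewrite /cart_edge !(eq_sym y.1, eq_sym y.2) !(@edge_sym _ y.1, @edge_sym _ y.2).
Qed.

Lemma cart_edge_irr : irreflexive cart_edge.
Proof. by move=> x; rewrite /cart_edge !edge_irr !andbF. Qed.

Definition cart_prod : sgraph := SGraph cart_edge_sym cart_edge_irr.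

End Product.

(* G^k = (..(G [] G) [] ..) [] G with k >= 1 factors; for k = 0, where the
   power is not used, this returns G. *)
Definition cart_pow (G : sgraph) (k : nat) : sgraph :=
  iter k.-1 (fun H => cart_prod H G) G.

Local Open Scope ring_scope.

Fixpoint g (R : realType) (n : nat) : {poly R} :=
  match n with
  | 0 => 1
  | 1 => 'X - 1
  | (n'.+1 as n1).+1 => ('X - 2) * g R n1 - g R n'
  end.

Definition is_min_pos_root (R : realType) (p : {poly R}) (b : R) : Prop :=
  [/\ 0 < b, root p b & forall x : R, 0 < x -> root p x -> b <= x].

(* The element b with is_min_pos_root (g R n) b, when there is one (it is then
   unique); 0 otherwise. *)
Definition beta (R : realType) (n : nat) : R :=
  xget 0 [set b : R | is_min_pos_root (g R n) b]%classic.

(* Main.v *)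
Require Import Defs.
From HB Require Import structures.
From mathcomp Require Import all_boot all_order all_algebra.
From mathcomp Require Import boolp classical_sets reals.
From mathcomp Require Import polyrcf ring lra zify.

Set Implicit Arguments.
Unset Strict Implicit.
Unset Printing Implicit Defensive.

Import Order.TTheory GRing.Theory Num.Theory.
Local Open Scope ring_scope.

(* A sign is attached to every edge of the grid so that the signed adjacency
   operators of the successive path factors anticommute.  The square norm of
   A y is then the sum of the square norms for the unsigned paths, taken along
   all lines of the grid, so a lower bound for one path lifts to the power: the
   constants add up for even paths, and for odd paths y is supported on the odd
   class, where an odd vertex (x, t) of the product of a smaller grid with a path
   has exactly one of x, t odd, so that the constant persists.  If S has more
   vertices than one bipartition class, there is a nonzero y supported on the
   other class within S such that A y is also supported on S, and then
   |A y| <= Delta(G[S]) |y|.  For even paths the constant beta_n comes from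
   completing squares, the pivots being ratios of the values (-1)^j g_j(x).
   For odd paths, alpha is the size of the even class, and shifting the parity
   of the inner even slices yields a sparse set with one more vertex. *)

(** * The polynomials g_n and their least positive roots *)

Lemma poly_first_root (R : rcfType) (p : {poly R}) (a b : R) :
  a < b -> 0 < p.[a] -> p.[b] < 0 ->
  exists c, [/\ a < c, c < b, root p c &
    forall x, a <= x -> x < c -> 0 < p.[x]].
Proof.
move=> ab pa pb.
have sgn c : c <= b -> {in `]a, c[, forall z : R, ~~ root p z} ->
    forall x, a <= x -> x < c -> 0 < p.[x].
  move=> cb nr x ax xc; rewrite ltNge; apply/negP => px.
  have [|z zax rz] := @poly_ivt R (- p) a x ax.
    by rewrite !hornerN oppr_le0 oppr_ge0 (ltW pa).
  move: rz; rewrite rootN => rz; case/andP: zax => az zx.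
  have az' : a != z by apply/eqP => eaz; move: rz pa; rewrite -eaz rootE => /eqP ->; rewrite ltxx.
  by have := nr z; rewrite in_itv /= lt_neqAle az' az (le_lt_trans zx xc) rz => /(_ isT).
case: (next_rootP p a b) => [p0|y pn0 py|c pn0 cE nr].
- by move: pa; rewrite p0 horner0 ltxx.
- rewrite in_itv /= => /andP[ay yb] nr; exists y; split => //; first exact/eqP.
  exact: sgn (ltW yb) nr.
(* In this case no root lies strictly between [a] and [b], against the sign change. *)
- have [|z] := @poly_ivt R (- p) a b (ltW ab).
    by rewrite !hornerN oppr_le0 oppr_ge0 (ltW pa) (ltW pb).
  rewrite rootN => /andP[az zb] rz.
  have za : a != z by apply: contraTneq pa => ->; rewrite (eqP rz) ltxx.
  have zb' : z != b by apply: contraTneq pb => <-; rewrite (eqP rz) ltxx.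
  by have := nr z; rewrite in_itv /= !lt_neqAle za az zb zb' rz => /(_ isT).
Qed.

Section SignedPolynomials.
Variable R : realType.

(** The sign normalises the value at 0 to 1, so each [sg j] stays positive up to its first positive
    root. *)
Definition sg (j : nat) (x : R) : R := (-1) ^+ j * (g R j).[x].

Lemma sg0 x : sg 0 x = 1.
Proof. by rewrite /sg expr0 mul1r /= hornerE. Qed.

Lemma sg1 x : sg 1 x = 1 - x.
Proof. by rewrite /sg expr1 [g R 1]/= hornerD hornerN hornerX -(polyC1 R) hornerC; ring. Qed.

Lemma sgSS j x : sg j.+2 x = (2 - x) * sg j.+1 x - sg j x.
Proof.
rewrite /sg (_ : g R j.+2 = ('X - 2) * g R j.+1 - g R j) //.
rewrite hornerD hornerN hornerM hornerD hornerN hornerX.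
by rewrite -(polyC_natr R 2) hornerC !exprS; ring.
Qed.

Lemma sg_at0 j : sg j 0 = 1.
Proof.
suff: sg j 0 = 1 /\ sg j.+1 0 = 1 by case.
elim: j => [|j [h1 h2]]; first by rewrite sg0 sg1; split=> //; ring.
by split=> //; rewrite sgSS h1 h2; ring.
Qed.

Lemma root_sg j x : root (g R j) x = (sg j x == 0).
Proof. by rewrite /sg mulf_eq0 signr_eq0. Qed.

(* At the least positive root b of g_(n+1) the recurrence reads
   sg (n+2) b = - sg n b < 0, so sg (n+2) has a root before b. *)
Lemma sg_first_root n : exists b : R,
  [/\ 0 < b, sg n.+1 b = 0,
      forall j x, (j <= n)%N -> 0 <= x -> x <= b -> 0 < sg j x &
      forall x, 0 <= x -> x < b -> 0 < sg n.+1 x].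
Proof.
elim: n => [|n [b [b0 rb pb qb]]].
  exists 1; split => [||j x|x]; rewrite ?ltr01 ?sg1 ?subrr //.
    by rewrite leqn0 => /eqP -> _ _; rewrite sg0.
  by rewrite subr_gt0.
have sgE x : ((-1) ^+ n.+2 *: g R n.+2).[x] = sg n.+2 x by rewrite hornerZ.
have [||c [c0 cb rc pc]] := @poly_first_root _ ((-1) ^+ n.+2 *: g R n.+2) 0 b b0.
- by rewrite sgE sg_at0.
- by rewrite sgE sgSS rb mulr0 sub0r oppr_lt0 pb // ltW.
exists c; split => // [||x x0 xc].
- by move: rc; rewrite rootE sgE => /eqP.
- move=> j x; rewrite leq_eqVlt => /orP[/eqP ->|jn] x0 xc.
    exact: qb x0 (le_lt_trans xc cb).
  exact: pb jn x0 (le_trans xc (ltW cb)).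
- by rewrite -sgE pc.
Qed.

(** The root b of [sg_first_root] shows that [xget] does not return its default 0. By minimality
    [beta R n] is at most b, so the positivity of the earlier [sg j] on [0, b] applies to it. *)
Lemma beta_spec n : (0 < n)%N ->
  is_min_pos_root (g R n) (beta R n) /\
  forall j, (j < n)%N -> 0 < sg j (beta R n).
Proof.
case: n => // n _; have [b [b0 rb pb qb]] := sg_first_root n.
have minb : is_min_pos_root (g R n.+1) b.
  split=> //; first by rewrite root_sg rb.
  move=> x x0; rewrite root_sg leNgt => /eqP rx; apply/negP => xb.
  by have := qb x (ltW x0) xb; rewrite rx ltxx.
have mm : is_min_pos_root (g R n.+1) (beta R n.+1).
  exact: (@xgetPex R 0 [set c | is_min_pos_root (g R n.+1) c]%classic (ex_intro _ b minb)).
split=> // j jn; apply: pb => //; first by case: mm => /ltW.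
by case: mm => _ _; apply=> //; rewrite root_sg rb.
Qed.

Lemma beta1 : beta R 1 = 1.
Proof.
have [[_]] := @beta_spec 1 isT.
by rewrite root_sg sg1 subr_eq0 => /eqP <-.
Qed.

(* Completing the square, by way of the successive Schur complements
   sg (j+1) x / sg j x of the tridiagonal form. *)
Lemma sg_schur x (a : nat -> R) j :
  (forall i, (i <= j)%N -> 0 < sg i x) ->
  sg j.+1 x * a j ^+ 2 + 2 * sg j x * a j * a j.+1 + sg j x * a j.+1 ^+ 2 <=
  sg j x * \sum_(i < j.+1) ((a i + a i.+1) ^+ 2 - x * a i ^+ 2).
Proof.
elim: j => [|j IH] pos.
  by rewrite big_ord1 sg0 sg1 /= le_eqVlt; apply/orP; left; apply/eqP; ring.
have {}IH := IH (fun i le_ij => pos i (leqW le_ij)).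
rewrite big_ord_recr /=; set F := \sum_(i < j.+1) _ in IH *.
have h0 := pos j (leqnSn j); have h1 := pos j.+1 (leqnn _).
rewrite sgSS; move: (sg j x) (sg j.+1 x) (a j) (a j.+1) (a j.+2) h0 h1 IH.
move=> h h' u v w h0 h1 IH.
(* Eliminates u: after multiplication by h, the bound [IH] times h' exceeds the left side by the
   square of h' u + h v. *)
have: (h' - h) * v ^+ 2 <= h' * F.
  rewrite -(ler_pM2l h0) [leRHS]mulrCA; apply: le_trans (ler_wpM2l (ltW h1) IH).
  rewrite -subr_ge0 (_ : _ - _ = (h' * u + h * v) ^+ 2) ?sqr_ge0 //; ring.
by move=> H; lra.
Qed.

(** In [sg_schur] with last index n - 1, the leading coefficient vanishes at the root and the other
    two terms vanish with [a n]. *)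
Lemma beta_energy n (a : nat -> R) : (0 < n)%N -> a n = 0 ->
  beta R n * \sum_(i < n) a i ^+ 2 <= \sum_(i < n) (a i + a i.+1) ^+ 2.
Proof.
case: n => // n _ an; have [[_ rb _] pos] := @beta_spec n.+1 isT.
have h0 := pos n (ltnSn n).
have := @sg_schur (beta R n.+1) a n (fun i => pos i).
move: rb; rewrite root_sg => /eqP ->; rewrite an mul0r mulr0 expr0n mulr0 !addr0.
by rewrite pmulr_rge0 // sumrB -mulr_sumr subr_ge0.
Qed.

End SignedPolynomials.

(** * The adjacency form of a path *)

Definition energy (R : comNzRingType) (G : finType) (w : G -> G -> R) (y : G -> R) : R :=
  \sum_u (\sum_v w u v * y v) ^+ 2.

Section PathEnergy.
Variable R : realType.

Definition path_weight (m : nat) (t t' : 'I_m) : R := (path_edge t t')%:R.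

(* The entry of index i is v (i - 1), with 0 for i = 0 and for i > m. *)
Definition padded (m : nat) (v : 'I_m -> R) (i : nat) : R :=
  \sum_(t < m) (t.+1 == i)%:R * v t.

Lemma padded_ord m (v : 'I_m -> R) (t : 'I_m) : padded v t.+1 = v t.
Proof.
rewrite /padded (bigD1 t) //= eqxx mul1r big1 ?addr0 // => t' tt'.
by rewrite eqSS val_eqE (negPf tt') mul0r.
Qed.

Lemma padded0 m (v : 'I_m -> R) : padded v 0 = 0.
Proof. by rewrite /padded big1 // => t _; rewrite mul0r. Qed.

Lemma padded_out m (v : 'I_m -> R) : padded v m.+1 = 0.
Proof.
by rewrite /padded big1 // => t _; rewrite eqSS (ltn_eqF (ltn_ord t)) mul0r.
Qed.

Lemma path_weightE m (v : 'I_m -> R) (t : 'I_m) :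
  \sum_t' path_weight t t' * v t' = padded v t + padded v t.+2.
Proof.
rewrite -big_split /=; apply: eq_bigr => t' _.
rewrite -mulrDl -natrD; congr (_%:R * _).
by rewrite /path_weight /path_edge eqSS (eq_sym (val t')); do 2 case: eqP => /=; lia.
Qed.

Lemma path_energyE m (v : 'I_m -> R) :
  energy (@path_weight m) v = \sum_(t < m) (padded v t + padded v t.+2) ^+ 2.
Proof. by apply: eq_bigr => t _; rewrite path_weightE. Qed.

Lemma sum_padded m (v : 'I_m -> R) :
  \sum_t v t ^+ 2 = \sum_(t < m) padded v t.+1 ^+ 2.
Proof. by apply: eq_bigr => t _; rewrite padded_ord. Qed.

Lemma big_ord_double (F : nat -> R) n :
  \sum_(t < n.*2) F t = \sum_(i < n) F i.*2 + \sum_(i < n) F i.*2.+1.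
Proof.
elim: n => [|n IH]; first by rewrite !big_ord0 addr0.
by rewrite doubleS !big_ord_recr /= IH; ring.
Qed.

Lemma beta_energy_rev n (b : nat -> R) : (0 < n)%N -> b 0 = 0 ->
  beta R n * \sum_(i < n) b i.+1 ^+ 2 <= \sum_(i < n) (b i + b i.+1) ^+ 2.
Proof.
move=> n0 b0.
have := @beta_energy R n (fun i => b (n - i)%N) n0; rewrite subnn => /(_ b0).
congr (_ * _ <= _); rewrite (reindex_inj rev_ord_inj); apply: eq_bigr => i _ /=.
  by rewrite subKn.
by rewrite subKn // -(subSn (ltn_ord i)) subSS subKn 1?ltnW // addrC.
Qed.

(** The rows split by parity into two chains of n squares: one on even padded indices, starting at
    the zero entry 0, and one on odd padded indices, ending at the zero entry 2n + 1. *)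
Lemma even_path_energy n (v : 'I_(2 * n) -> R) : (0 < n)%N ->
  beta R n * \sum_t v t ^+ 2 <= energy (@path_weight (2 * n)) v.
Proof.
move=> n0; rewrite path_energyE sum_padded.
have := padded0 v; have := padded_out v; move: (padded v) => {v} V Vout V0.
move: Vout; rewrite mul2n => Vout.
rewrite (big_ord_double (fun t => V t.+1 ^+ 2)).
rewrite (big_ord_double (fun t => (V t + V t.+2) ^+ 2)) mulrDr addrC.
apply: lerD.
  exact: (@beta_energy_rev n (fun i => V i.*2)).
exact: (@beta_energy R n (fun i => V i.*2.+1)).
Qed.

Lemma odd_supported_padded n (v : 'I_n.*2.+1 -> R) :
  (forall t : 'I_n.*2.+1, ~~ odd t -> v t = 0) ->
  \sum_t v t ^+ 2 = \sum_(i < n) padded v i.*2.+2 ^+ 2.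
Proof.
move=> sv; rewrite sum_padded big_ord_recr /=.
have -> : padded v n.*2.+1 = 0.
  by have := padded_ord v ord_max => /= ->; rewrite sv //= odd_double.
rewrite expr0n addr0 (big_ord_double (fun t => padded v t.+1 ^+ 2)) big1 ?add0r // => i _.
have hi : (i.*2 < n.*2.+1)%N by rewrite ltnS leq_double ltnW.
by have := padded_ord v (Ordinal hi) => /= ->; rewrite sv ?expr0n //= odd_double.
Qed.

(** Odd vertices sit at even padded indices, and the rows 0, 2, ..., 2n - 2 form a chain starting at
    zero. The last row and the odd rows are squares and are dropped. *)
Lemma odd_path_energy n (v : 'I_n.*2.+1 -> R) : (0 < n)%N ->
  (forall t : 'I_n.*2.+1, ~~ odd t -> v t = 0) ->
  beta R n * \sum_t v t ^+ 2 <= energy (@path_weight n.*2.+1) v.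
Proof.
move=> n0 sv; rewrite odd_supported_padded // path_energyE big_ord_recr /=.
rewrite (big_ord_double (fun t => (padded v t + padded v t.+2) ^+ 2)).
have := @beta_energy_rev n (fun i => padded v i.*2) n0 (padded0 v) => /le_trans; apply.
rewrite -addrA lerDl addr_ge0 ?sqr_ge0 // sumr_ge0 // => i _; exact: sqr_ge0.
Qed.

(** Both end rows contribute the square of the middle entry; keeping the last row improves the
    constant from [beta R 1] = 1 to 2. *)
Lemma path3_energy (v : 'I_3 -> R) : (forall t : 'I_3, ~~ odd t -> v t = 0) ->
  2 * \sum_t v t ^+ 2 <= energy (@path_weight 3) v.
Proof.
move=> sv; rewrite (@odd_supported_padded 1) // path_energyE big_ord1 /=.
rewrite !big_ord_recr big_ord0 /= padded0 (padded_out v).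
have := sqr_ge0 (padded v 1 + padded v 3); lra.
Qed.

End PathEnergy.

(** * Signed adjacency operators and interlacing *)

Section Signings.
Variable R : realType.

(** The condition on squares says that [w] is 1 or -1 on edges and 0 elsewhere; [p] is a proper
    2-colouring. *)
Definition signing (G : sgraph) (p : G -> bool) (w : G -> G -> R) : Prop :=
  [/\ forall u v, w u v = w v u,
      forall u v, w u v ^+ 2 = (edge u v)%:R &
      forall u v, edge u v -> p u != p v].

(** The entries on [X] are unknowns and each element of [Y] is a linear equation, so there are more
    unknowns than equations. *)
Lemma exists_kernel_vector (T : finType) (w : T -> T -> R) (X Y : {set T}) :
  (#|Y| < #|X|)%N ->
  exists y : T -> R, [/\ exists x, y x != 0, forall x, x \notin X -> y x = 0 &
    forall u, u \in Y -> \sum_v w u v * y v = 0].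
Proof.
move=> YX; pose M := \matrix_(i < #|X|, j < #|Y|) w (enum_val j) (enum_val i).
have /rowV0Pn[r /sub_kermxP rM r0] : kermx M != 0.
  rewrite -mxrank_eq0 mxrank_ker subn_eq0 -ltnNge.
  exact: leq_ltn_trans (rank_leq_col M) YX.
(* At most one term occurs: this extends [r] by zero outside [X]. *)
pose y x := \sum_(i < #|X| | enum_val i == x) r 0 i.
have yE i : y (enum_val i) = r 0 i.
  rewrite /y (big_pred1 i) // => j; exact: (inj_eq enum_val_inj).
exists y; split.
- have /existsP[i ri] : [exists i, r 0 i != 0].
    apply: contraNT r0; rewrite negb_exists => /forallP r0.
    by apply/eqP/rowP => i; rewrite mxE; apply/eqP; rewrite -[_ == _]negbK r0.
  by exists (enum_val i); rewrite yE.
- move=> x xX; rewrite /y big_pred0 // => i.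
  by apply: contraNF xX => /eqP <-; exact: enum_valP.
- move=> u uY; have := congr1 (fun A : 'rV_ _ => A 0 (enum_rank_in uY u)) rM.
  rewrite !mxE; apply: etrans; rewrite (bigID (mem X)) /= [X in _ + X]big1 ?addr0; last first.
    move=> x xX; rewrite /y big_pred0 ?mulr0 // => i.
    by apply: contraNF xX => /eqP <-; exact: enum_valP.
  rewrite big_enum_val; apply: eq_bigr => i _.
  by rewrite !mxE yE enum_rankK_in // mulrC.
Qed.

(** Cauchy-Schwarz against the constant vector, by expanding the squares of all differences. *)
Lemma sqr_sum_le (I : finType) (N : {set I}) (a : I -> R) :
  (\sum_(i in N) a i) ^+ 2 <= #|N|%:R * \sum_(i in N) a i ^+ 2.
Proof.
have : 0 <= \sum_(i in N) \sum_(j in N) (a i - a j) ^+ 2.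
  by apply: sumr_ge0 => i _; apply: sumr_ge0 => j _; exact: sqr_ge0.
have -> : \sum_(i in N) \sum_(j in N) (a i - a j) ^+ 2 =
    2 * (#|N|%:R * \sum_(i in N) a i ^+ 2 - (\sum_(i in N) a i) ^+ 2).
  under eq_bigr => i _.
    under eq_bigr => j _ do rewrite sqrrB.
    rewrite big_split sumrB /= sumr_const sumrMnl -mulr_sumr; over.
  rewrite big_split sumrB /= sumr_const sumrMnl sumrMnl -mulr_suml.
  by rewrite -!(mulr_natl (\sum_(i in N) a i ^+ 2)); ring.
by rewrite pmulr_rge0 ?ltr0n // subr_ge0.
Qed.

Definition set_degree (G : sgraph) (S : {set G}) (x : G) : nat :=
  #|[set y in S | edge x y]|.

Lemma induced_degree (G : sgraph) (S : {set G}) (x : induced S) :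
  degree x = set_degree S (val x).
Proof.
rewrite /degree -(card_imset _ val_inj); apply: eq_card => y.
rewrite inE; apply/imsetP/andP => [[z]|[yS xy]].
  by rewrite inE => xz ->; split=> //; exact: valP.
by exists (Sub y yS); rewrite ?inE // SubK.
Qed.

Lemma set_degree_le (G : sgraph) (S : {set G}) (x : G) :
  x \in S -> (set_degree S x <= max_degree (induced S))%N.
Proof.
by move=> xS; rewrite -[x](SubK {x | x \in S} xS) -(@induced_degree G S) leq_bigmax.
Qed.

Lemma max_degree_leP (G : sgraph) (S : {set G}) d :
  (forall x, x \in S -> (set_degree S x <= d)%N) -> (max_degree (induced S) <= d)%N.
Proof. by move=> H; apply/bigmax_leqP => x _; rewrite induced_degree H //; exact: valP. Qed.

(** Cauchy-Schwarz on each row of [S] costs one factor D, the row having at most D entries within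
    [S]. After exchanging the sums, each [y v ^+ 2] is counted at most D times, which gives the
    second factor. *)
Lemma energy_le_degree (G : sgraph) p (w : G -> G -> R) (S : {set G}) (y : G -> R) :
  signing p w -> (forall u, u \notin S -> y u = 0) ->
  (forall u, u \notin S -> \sum_v w u v * y v = 0) ->
  energy w y <= (max_degree (induced S))%:R ^+ 2 * \sum_v y v ^+ 2.
Proof.
move=> [wC w2 _] y0 wy0; set D := (max_degree _)%:R : R.
have row u : u \in S ->
    (\sum_v w u v * y v) ^+ 2 <= D * \sum_(v in S) (edge u v)%:R * y v ^+ 2.
  move=> uS; have -> : \sum_v w u v * y v = \sum_(v in [set v in S | edge u v]) w u v * y v.
    rewrite [RHS]big_mkcond; apply: eq_bigr => v _; rewrite inE.
    have [vS /=|/y0 -> /=] := boolP (v \in S); last by rewrite mulr0.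
    case: ifPn => // /negPf e; have := w2 u v; rewrite e => /eqP.
    by rewrite sqrf_eq0 => /eqP ->; rewrite mul0r.
  apply: le_trans (sqr_sum_le _ _) _; apply: ler_pM.
  - exact: ler0n.
  - by apply: sumr_ge0 => v _; exact: sqr_ge0.
  - by rewrite ler_nat set_degree_le.
  - rewrite [leRHS](bigID (edge u)) /= [X in _ + X]big1 ?addr0; last first.
      by move=> v /andP[_ /negPf ->]; rewrite mul0r.
    rewrite le_eqVlt; apply/orP; left; apply/eqP; apply: eq_big => [v|v].
      by rewrite inE.
    by rewrite inE => /andP[_ e]; rewrite exprMn w2 e.
rewrite /energy (bigID (mem S)) /= [X in _ + X]big1 ?addr0; last first.
  by move=> u /wy0 ->; rewrite expr0n.
apply: le_trans (ler_sum _ row) _.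
rewrite -mulr_sumr expr2 -mulrA ler_wpM2l ?ler0n //.
rewrite exchange_big /= [X in _ * X](bigID (mem S)) /= [X in _ * (_ + X)]big1 ?addr0; last first.
  by move=> u /y0 ->; rewrite expr0n.
rewrite mulr_sumr; apply: ler_sum => v vS.
rewrite -mulr_suml ler_wpM2r ?sqr_ge0 // -natr_sum ler_nat.
apply: leq_trans (set_degree_le vS); rewrite /set_degree -sum1_card big_mkcond.
rewrite [leqRHS]big_mkcond; apply: leq_sum => u _; rewrite inE (edge_sym v u).
by case: (u \in S); case: edge.
Qed.

(* Interlacing by hand: the vectors supported on the part of S in the class b
   outnumber the equations asking A y to vanish outside S. *)
Lemma energy_bound_max_degree (G : sgraph) p (w : G -> G -> R) (S : {set G}) (b : bool) (c : R) :
  signing p w ->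
  (forall y, (forall u, p u != b -> y u = 0) -> c * \sum_v y v ^+ 2 <= energy w y) ->
  (#|[set u | p u != b]| < #|S|)%N ->
  c <= (max_degree (induced S))%:R ^+ 2.
Proof.
move=> sw lb big_S; pose X := [set u in S | p u == b]; pose Y := [set u | p u != b] :\: S.
(* [X] and [Y] arise from [S] and the class opposite to [b] by removing their common part, so
   [big_S] carries over. *)
have YX : (#|Y| < #|X|)%N.
  have := cardsID S [set u | p u != b]; have := cardsID [set u | p u == b] S.
  have -> : S :&: [set u | p u == b] = X by apply/setP => u; rewrite !inE.
  have -> : S :\: [set u | p u == b] = [set u | p u != b] :&: S by apply/setP => u; rewrite !inE.
  by rewrite -/Y; move: big_S; lia.
have [y [[x yx] yX wyY]] := @exists_kernel_vector G w X Y YX.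
have n0 : 0 < \sum_v y v ^+ 2.
  rewrite (bigD1 x) //= ltr_pwDl ?lt_def ?sqrf_eq0 ?yx ?sqr_ge0 //.
  by apply: sumr_ge0 => v _; exact: sqr_ge0.
rewrite -(ler_pM2r n0); apply: le_trans (lb y _) (energy_le_degree sw _ _).
- by move=> u pu; apply: yX; rewrite inE (negPf pu) andbF.
- by move=> u uS; apply: yX; rewrite inE (negPf uS).
(* For [u] in class [b] the row vanishes automatically: its neighbours lie in the other class, where
   [y] is zero. *)
- move=> u uS; have [pu|pu] := boolP (p u == b); last by apply: wyY; rewrite !inE uS pu.
  rewrite big1 // => v _; have [pv|pv] := boolP (p v == b); last first.
    by rewrite yX ?mulr0 // inE (negPf pv) andbF.
  case: sw => _ w2 bip; have := w2 u v; case: (boolP (edge u v)) => [/bip|_ /eqP].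
    by rewrite (eqP pu) (eqP pv) eqxx.
  by rewrite sqrf_eq0 => /eqP ->; rewrite mul0r.
Qed.

End Signings.

(** * Cartesian products with a path *)

Lemma antisymmetric_sum0 (R : numDomainType) (I : finType) (K : I -> I -> R) :
  (forall i j, K j i = - K i j) -> \sum_i \sum_j K i j = 0.
Proof.
move=> KN; apply/eqP; rewrite -[_ == 0](mulrn_eq0 _ 2) mulr2n.
rewrite [X in X + _]exchange_big -big_split big1 //= => i _.
by rewrite -big_split big1 //= => j _; rewrite KN addNr.
Qed.

Lemma sum_pair (R : nmodType) (I J : finType) (F : I * J -> R) :
  \sum_u F u = \sum_i \sum_j F (i, j).
Proof. by rewrite (pair_bigA _ (fun i j => F (i, j))); apply: eq_bigr => -[]. Qed.

Section PathProduct.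
Variables (R : realType) (G : sgraph) (m : nat).
Variables (p : G -> bool) (w : G -> G -> R).
Hypothesis sw : signing p w.

Lemma path_signing :
  @signing R (path_graph m) (fun t : 'I_m => odd t) (@path_weight R m).
Proof.
split=> [t t'|t t'|t t'].
- by rewrite /path_weight path_edge_sym.
- by rewrite /path_weight /=; case: path_edge; rewrite ?expr1n ?expr0n.
- by case/orP => /eqP <- /=; case: odd.
Qed.

Definition prod_parity (u : cart_prod G (path_graph m)) : bool := p u.1 (+) odd u.2.

(* The alternating sign makes the two directions anticommute, so that their
   squares add up. *)
Definition prod_weight (u v : cart_prod G (path_graph m)) : R :=
  (-1) ^+ u.2 * w u.1 v.1 * (u.2 == v.2)%:R + (u.1 == v.1)%:R * path_weight R u.2 v.2.

Lemma prod_signing : signing prod_parity prod_weight.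
Proof.
case: sw => wC w2 bip; case: path_signing => PC P2 Pbip.
split=> [[x t] [x' t']|[x t] [x' t']|[x t] [x' t']]; rewrite /prod_weight /prod_parity /=.
- rewrite wC PC (eq_sym x) (eq_sym t); case: eqP => [->|_] //.
  by rewrite !mulr0.
- rewrite /edge /= /cart_edge /= (eq_sym x).
  have [<-|] := eqVneq x' x.
    have [<-|] := eqVneq t t'.
      have -> : path_weight R t t = 0 by rewrite /path_weight path_edge_irr.
      rewrite mulr1 mulr0 addr0 exprMn sqrr_sign mul1r w2 edge_irr.
      by rewrite path_edge_irr.
    by rewrite /= mulr0n mulr1n mulr0 add0r mul1r P2 orbF.
  rewrite /= mulr0n mul0r addr0 => _; case: eqVneq => _ /=.
    by rewrite mulr1n mulr1 exprMn sqrr_sign mul1r w2.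
  by rewrite mulr0n mulr0 expr0n.
- case/orP => /= /andP[/eqP <-].
    by move/Pbip; case: (p x); case: odd; case: odd.
  by move/bip; case: (p x); case: (p x'); case: odd.
Qed.

Lemma prod_energy (y : cart_prod G (path_graph m) -> R) :
  energy prod_weight y =
  \sum_t energy w (fun x => y (x, t)) + \sum_x energy (@path_weight R m) (fun t => y (x, t)).
Proof.
case: sw => wC _ _; case: path_signing => PC P2 Pbip.
pose a (u : G * 'I_m) : R := \sum_x' w u.1 x' * y (x', u.2).
pose b (u : G * 'I_m) : R := \sum_t' path_weight R u.2 t' * y (u.1, t').
have row (u : G * 'I_m) : \sum_v prod_weight u v * y v = (-1) ^+ u.2 * a u + b u.
  rewrite (sum_pair (fun v : G * 'I_m => prod_weight u v * y v)).
  rewrite /prod_weight /=; under eq_bigr do under eq_bigr do rewrite mulrDl.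
  under eq_bigr do rewrite big_split /=.
  rewrite big_split /=; congr (_ + _).
    rewrite /a mulr_sumr; apply: eq_bigr => x' _.
    rewrite (bigD1 u.2) //= eqxx mulr1 big1 ?addr0 ?mulrA // => t' /negPf tt'.
    by rewrite eq_sym tt' mulr0 mul0r.
  rewrite (bigD1 u.1) //= [X in _ + X]big1 ?addr0 => [|x' /negPf xx'].
    by apply: eq_bigr => t' _; rewrite eqxx mul1r.
  by rewrite big1 // => t' _; rewrite eq_sym xx' !mul0r.
(* Expanded over pairs of vertices, the cross term is antisymmetric: adjacent positions t and t'
   have opposite signs, and the other factors are symmetric. *)
have cross : \sum_(u : G * 'I_m) (-1) ^+ u.2 * (a u * b u) = 0.
  pose K (u v : G * 'I_m) : R :=
    (-1) ^+ u.2 * (w u.1 v.1 * y (v.1, u.2) * (path_weight R u.2 v.2 * y (u.1, v.2))).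
  rewrite -[RHS](@antisymmetric_sum0 R _ K) => [|[x t] [x' t']].
    apply: eq_bigr => u _; rewrite /a /b big_distrlr /= mulr_sumr.
    rewrite (sum_pair (K u)).
    by apply: eq_bigr => x' _; rewrite mulr_sumr.
  rewrite /K /= (wC x' x) (PC t' t).
  case: (boolP (path_edge t t')) => e; last first.
    by rewrite /path_weight (negPf e) !(mul0r, mulr0) oppr0.
  have := Pbip t t' e; rewrite -(signr_odd _ t) -(signr_odd _ t').
  by case: (odd t); case: (odd t') => //= _; rewrite ?expr0 ?expr1; ring.
transitivity (\sum_(u : G * 'I_m) a u ^+ 2 + \sum_(u : G * 'I_m) b u ^+ 2 +
    2 * \sum_(u : G * 'I_m) (-1) ^+ u.2 * (a u * b u)).
  rewrite mulr_sumr -!big_split /=; apply: eq_bigr => u _.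
  by rewrite row sqrrD exprMn sqrr_sign; ring.
rewrite cross mulr0 addr0.
rewrite (sum_pair (fun u => a u ^+ 2)) (sum_pair (fun u => b u ^+ 2)).
by rewrite exchange_big.
Qed.

Lemma prod_energy_ge c d :
  (forall y, c * \sum_x y x ^+ 2 <= energy w y) ->
  (forall v, d * \sum_t v t ^+ 2 <= energy (@path_weight R m) v) ->
  forall y, (c + d) * \sum_u y u ^+ 2 <= energy prod_weight y.
Proof.
move=> lbG lbP y; rewrite prod_energy mulrDl (sum_pair (fun u => y u ^+ 2)); apply: lerD.
  rewrite exchange_big mulr_sumr; apply: ler_sum => t _; exact: lbG.
rewrite mulr_sumr; apply: ler_sum => x _; exact: lbP.
Qed.

Lemma energy_ge0 (H : finType) (w' : H -> H -> R) y : 0 <= energy w' y.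
Proof. by apply: sumr_ge0 => u _; exact: sqr_ge0. Qed.

(* An odd vertex of the product is odd in exactly one coordinate. *)
Lemma prod_odd_energy_ge c :
  (forall y, (forall x, ~~ p x -> y x = 0) -> c * \sum_x y x ^+ 2 <= energy w y) ->
  (forall v, (forall t : 'I_m, ~~ odd t -> v t = 0) ->
     c * \sum_t v t ^+ 2 <= energy (@path_weight R m) v) ->
  forall y, (forall u, ~~ prod_parity u -> y u = 0) ->
    c * \sum_u y u ^+ 2 <= energy prod_weight y.
Proof.
move=> lbG lbP y y0; rewrite prod_energy (sum_pair (fun u => y u ^+ 2)).
have -> : \sum_x \sum_t y (x, t) ^+ 2 =
    \sum_(t < m | ~~ odd t) \sum_x y (x, t) ^+ 2 + \sum_(x | ~~ p x) \sum_t y (x, t) ^+ 2.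
  rewrite [X in _ + X]big_mkcond [X in X + _]big_mkcond exchange_big /=.
  rewrite [X in X + _](_ : _ = \sum_(t < m) \sum_x (~~ odd t)%:R * y (x, t) ^+ 2); last first.
    apply: eq_bigr => t _; case: odd => /=; last by under [RHS]eq_bigr do rewrite mul1r.
    by rewrite big1 // => x _; rewrite mul0r.
  rewrite [X in _ + X](_ : _ = \sum_x \sum_(t < m) (~~ p x)%:R * y (x, t) ^+ 2); last first.
    apply: eq_bigr => x _; case: p => /=; last by under [RHS]eq_bigr do rewrite mul1r.
    by rewrite big1 // => t _; rewrite mul0r.
  rewrite [X in _ + X]exchange_big -big_split; apply: eq_bigr => t _.
  rewrite -big_split; apply: eq_bigr => x _ /=; have := y0 (x, t); rewrite /prod_parity /=.
  by (case: p; case: odd) => /= [/(_ isT) ->|_|_|/(_ isT) ->];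
    rewrite /= ?mulr1n ?mulr0n ?expr0n ?mul1r ?mul0r ?mulr0 ?addr0 ?add0r.
(* Only the slices with t even and the lines with x even are kept; there [y] is supported on odd
   vertices of the factor, and the other energies are nonnegative. *)
rewrite mulrDr; apply: lerD.
  rewrite [leRHS](bigID (fun t : 'I_m => ~~ odd t)) /= -[leLHS]addr0 lerD //; last first.
    by apply: sumr_ge0 => t _; exact: energy_ge0.
  rewrite mulr_sumr; apply: ler_sum => t /negPf ot; apply: lbG => x px.
  by apply: y0; rewrite /prod_parity /= ot addbF.
rewrite [leRHS](bigID (fun x => ~~ p x)) /= -[leLHS]addr0 lerD //; last first.
  by apply: sumr_ge0 => x _; exact: energy_ge0.
rewrite mulr_sumr; apply: ler_sum => x /negPf px; apply: lbP => t ot.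
by apply: y0; rewrite /prod_parity /= px.
Qed.

(** Taking [odd] or its negation for [q] counts the two bipartition classes, and [inner] counts the
    sparse set. *)
Lemma card_prod_parity (q : 'I_m -> bool) :
  #|[set u : cart_prod G (path_graph m) | p u.1 == q u.2]| =
  (#|[set x | p x]| * #|[set t | q t]| + #|[set x | ~~ p x]| * #|[set t | ~~ q t]|)%N.
Proof.
rewrite -!cardsX -cardsUI [X in (_ + X)%N](_ : _ = 0%N) ?addn0.
  by apply: eq_card => u; rewrite !inE; case: (p _); case: (q _).
by apply/eqP; rewrite cards_eq0; apply/eqP/setP => u; rewrite !inE; case: (p _); rewrite ?andbF.
Qed.

End PathProduct.

(** * The parameters alpha and f *)

Lemma max_degree_le_card (G : sgraph) (S : {set G}) : (max_degree (induced S) <= #|G|)%N.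
Proof. by apply: max_degree_leP => x _; rewrite /set_degree max_card. Qed.

Lemma f_le (G : sgraph) (S : {set G}) : #|S| = (alpha G).+1 ->
  (f G <= max_degree (induced S))%N.
Proof.
move=> cS; rewrite /f -minEnat.
exact: (@bigmin_le_cond _ _ _ _ S _ (fun S : {set G} => max_degree (induced S)) (introT eqP cS)).
Qed.

(** The first alternative is the default value of the minimum. *)
Lemma f_attained (G : sgraph) : f G = #|G| \/
  exists S : {set G}, #|S| = (alpha G).+1 /\ f G = max_degree (induced S).
Proof.
rewrite /f; elim/big_rec: _ => [|S d /eqP cS IH]; first by left.
by rewrite /minn; case: ifP => // _; right; exists S.
Qed.

Lemma f_ge (G : sgraph) d : (d <= #|G|)%N ->
  (forall S : {set G}, #|S| = (alpha G).+1 -> (d <= max_degree (induced S))%N) ->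
  (d <= f G)%N.
Proof.
move=> dG dS; rewrite /f -minEnat -leEnat; apply: le_bigmin => // S /eqP cS.
exact: dS.
Qed.

Lemma max_degree_independent (G : sgraph) (S : {set G}) :
  independent S = (max_degree (induced S) == 0)%N.
Proof.
apply/idP/idP => [/forall_inP iS|/eqP D0].
  rewrite -leqn0; apply: max_degree_leP => x xS; rewrite leqn0 cards_eq0.
  apply/eqP/setP => y; rewrite !inE; apply/negP => /andP[yS xy].
  by have /forall_inP/(_ y yS) := iS x xS; rewrite xy.
apply/forall_inP => x xS; apply/forall_inP => y yS; apply/negP => xy.
have := set_degree_le xS; rewrite D0 leqn0 cards_eq0 => /eqP/setP/(_ y).
by rewrite !inE yS xy.
Qed.

Lemma alpha_lt_max_degree (G : sgraph) (S : {set G}) : (alpha G < #|S|)%N ->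
  (0 < max_degree (induced S))%N.
Proof.
rewrite lt0n -max_degree_independent; apply: contraTN => iS; rewrite -leqNgt.
exact: (@leq_bigmax_cond _ _ (fun S : {set G} => #|S|) S iS).
Qed.

Lemma class_le_alpha (R : realType) (G : sgraph) p (w : G -> G -> R) b : signing p w ->
  (#|[set u | p u != b]| <= alpha G)%N.
Proof.
case=> _ _ bip; apply: (@leq_bigmax_cond _ _ (fun S : {set G} => #|S|)).
apply/forall_inP => x; rewrite inE => px; apply/forall_inP => y; rewrite inE => py.
by apply/negP => /bip; move: px py; case: (p x); case: (p y); case: b.
Qed.

(** * Powers of odd and even paths *)

Lemma card_odd_ord n : #|[set t : 'I_n.*2.+1 | odd t]| = n.
Proof.
rewrite -sum1_card big_mkcond; under eq_bigr do rewrite inE.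
elim: n => [|j IH]; first by rewrite big_ord1.
by rewrite doubleS 2!big_ord_recr /= IH /= odd_double /= addn0 addn1.
Qed.

Lemma card_even_ord n : #|[set t : 'I_n.*2.+1 | ~~ odd t]| = n.+1.
Proof.
have := cardsC [set t : 'I_n.*2.+1 | odd t]; rewrite card_odd_ord card_ord.
by rewrite (_ : ~: _ = [set t : 'I_n.*2.+1 | ~~ odd t]); [lia | apply/setP => t; rewrite !inE].
Qed.

(* The sparse set takes over t the vertices x with p x = inner t; for n > 1 only
   the two end slices agree with a neighbouring slice. *)
Definition inner n (t : 'I_n.*2.+1) : bool := [&& (0 < t)%N, (t < n.*2)%N & ~~ odd t].

Lemma card_inner n : (0 < n)%N -> #|[set t : 'I_n.*2.+1 | inner t]|.+1 = n.
Proof.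
move=> n0; rewrite -sum1_card big_mkcond big_ord_recr /= inE /inner /= ltnn andbF addn0.
under eq_bigr => t _ do rewrite inE /inner /= ltn_ord /=.
case: n n0 => // j _; elim: j => [|j IH]; first by rewrite !big_ord_recr big_ord0.
by rewrite doubleS 2!big_ord_recr /= odd_double /= addn0 addn1 IH.
Qed.

Lemma card_outer n : (0 < n)%N -> #|[set t : 'I_n.*2.+1 | ~~ inner t]| = n.+2.
Proof.
move=> n0; have := cardsC [set t : 'I_n.*2.+1 | inner t]; have := card_inner n0; rewrite card_ord.
rewrite (_ : ~: _ = [set t : 'I_n.*2.+1 | ~~ inner t]); last by apply/setP => t; rewrite !inE.
by move: #|_| #|_| => a b; lia.
Qed.

Section OddGrids.
Variables (R : realType) (n : nat).
Local Notation m := n.*2.+1.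
Local Notation P := (path_graph m).

Definition odd_grid (c : R) (G : sgraph) (p : G -> bool) (w : G -> G -> R) : Prop :=
  [/\ signing p w,
      forall y, (forall x, ~~ p x -> y x = 0) -> c * \sum_x y x ^+ 2 <= energy w y &
      #|[set x | ~~ p x]| = #|[set x | p x]|.+1].

Lemma odd_grid_max_degree c (G : sgraph) p (w : G -> G -> R) (S : {set G}) :
  odd_grid c p w -> (#|[set x | ~~ p x]| < #|S|)%N ->
  c <= (max_degree (induced S))%:R ^+ 2.
Proof.
case=> sw lb _ cS; apply: (energy_bound_max_degree (b := true) sw).
  by move=> y y0; apply: lb => x px; apply: y0; rewrite eqb_id.
by rewrite (_ : [set u | _] = [set x | ~~ p x]) //; apply/setP => x; rewrite !inE eqb_id.
Qed.

(** The even class is independent, and any larger set has maximum degree D with 0 < c <= D^2, so it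
    is not. *)
Lemma odd_grid_alpha c (G : sgraph) p (w : G -> G -> R) : 0 < c -> odd_grid c p w ->
  alpha G = #|[set x | ~~ p x]|.
Proof.
move=> c0 og; have [sw _ _] := og; apply/eqP; rewrite eqn_leq; apply/andP; split.
  apply/bigmax_leqP => S; rewrite max_degree_independent leqNgt => /eqP D0; apply/negP.
  by move/(odd_grid_max_degree og); rewrite D0 expr0n /= leNgt c0.
apply: leq_trans (class_le_alpha true sw); apply: subset_leq_card.
by apply/fintype.subsetP => x; rewrite !inE eqb_id.
Qed.

Section Bounds.
Variable c : R.
Hypothesis path_bound : forall v, (forall t : 'I_m, ~~ odd t -> v t = 0) ->
  c * \sum_t v t ^+ 2 <= energy (@path_weight R m) v.

Lemma odd_grid_path : @odd_grid c P (fun t : 'I_m => odd t) (@path_weight R m).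
Proof.
by split; [exact: path_signing | exact: path_bound | rewrite card_even_ord card_odd_ord].
Qed.

Lemma odd_grid_prod (G : sgraph) p (w : G -> G -> R) : odd_grid c p w ->
  @odd_grid c (cart_prod G P) (@prod_parity G m p) (@prod_weight R G m w).
Proof.
case=> sw lb cp; split; first exact: prod_signing.
  exact: prod_odd_energy_ge.
have := card_prod_parity p (fun t : 'I_m => odd t).
have := card_prod_parity p (fun t : 'I_m => ~~ odd t).
rewrite (_ : [set t : 'I_m | ~~ ~~ odd t] = [set t : 'I_m | odd t]); last first.
  by apply/setP => t; rewrite !inE negbK.
rewrite card_even_ord card_odd_ord cp.
rewrite (_ : [set u | _ == ~~ _] = [set u | @prod_parity G m p u]); last first.
  by apply/setP => u; rewrite !inE /prod_parity; case: (p _); case: odd.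
rewrite (_ : [set u | _ == odd _] = [set u | ~~ @prod_parity G m p u]); last first.
  by apply/setP => u; rewrite !inE /prod_parity; case: (p _); case: odd.
(* With a odd vertices in [G], the classes have a n + (a + 1)(n + 1) and a (n + 1) + (a + 1) n
   elements, which differ by one. *)
move=> -> ->; lia.
Qed.

Lemma odd_grid_pow j : exists p w, @odd_grid c (iter j (fun H => cart_prod H P) P) p w.
Proof.
elim: j => [|j [p [w og]]].
  by exists (fun t : 'I_m => odd t), (@path_weight R m); exact: odd_grid_path.
by exists (@prod_parity _ m p), (@prod_weight R _ m w); exact: odd_grid_prod.
Qed.

Lemma exists_sparse_set j d : (0 < n)%N -> 0 < c ->
  (forall t : 'I_m, #|[set t' | path_edge t t' & inner t' == inner t]| <= d)%N ->
  exists S : {set iter j (fun H => cart_prod H P) P},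
    #|S| = (alpha (iter j (fun H => cart_prod H P) P)).+1 /\
    (max_degree (induced S) <= d)%N.
Proof.
move=> n0 c0 deg; case: j => [|j].
  (* On a single path, the n odd vertices and the two ends. *)
  exists [set t : 'I_m | ~~ inner t]; split.
    by rewrite (odd_grid_alpha c0 odd_grid_path) card_even_ord (card_outer n0).
  apply: max_degree_leP => t; rewrite inE => it; apply: leq_trans (deg t).
  apply: subset_leq_card; apply/fintype.subsetP => t'; rewrite !inE => /andP[it' tt'].
  by apply/andP; split; [exact: tt' | rewrite (negPf it) (negPf it')].
have [p [w og]] := odd_grid_pow j.
set G := iter j _ P in p w og *; change (iter j.+1 _ P) with (cart_prod G P).
(* Compared with the even class, one more slice has the size of the larger class of [G] and one
   fewer that of the smaller class: n + 2 and n - 1 instead of n + 1 and n. This gains exactly one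
   vertex. *)
exists [set u : cart_prod G P | p u.1 == inner u.2]; split.
  rewrite (odd_grid_alpha c0 (odd_grid_prod og)) card_prod_parity (card_outer n0).
  have := card_inner n0; have := card_prod_parity p (fun t : 'I_m => odd t).
  rewrite (_ : [set u | _ == odd _] = [set u | ~~ @prod_parity G m p u]); last first.
    by apply/setP => u; rewrite !inE /prod_parity; case: (p _); case: odd.
  case: og => _ _ ->; rewrite card_even_ord card_odd_ord => ->.
  by move: #|_| #|[set t | inner t]| => a i <-; lia.
apply: max_degree_leP => -[x t]; rewrite inE /= => /eqP pxt; apply: leq_trans (deg t).
rewrite -(card_imset _ (_ : injective (fun t' : 'I_m => (x, t')))); last by move=> ? ? [].
apply: subset_leq_card; apply/fintype.subsetP => -[x' t']; rewrite !inE /= => /andP[/eqP pxt'].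
(* Edges along the path stay over x and need equal values of [inner]; edges of [G] change [p] within
   a slice and so leave the set. *)
case/orP => /= /andP[/eqP e e'].
  by rewrite -e; apply: imset_f; rewrite inE e' -pxt -pxt' e eqxx.
case: og => -[_ _ /(_ _ _ e')] + _ _.
by rewrite pxt pxt' e eqxx.
Qed.

End Bounds.
End OddGrids.

Lemma path3_degree (t : 'I_3) (q : pred 'I_3) : (#|[set t' | path_edge t t' & q t']| <= 2)%N.
Proof.
have c2 : #|[set~ t]| = 2%N by rewrite cardsC1 card_ord.
rewrite -[leqRHS]c2; apply: subset_leq_card; apply/fintype.subsetP => t'.
by rewrite !inE => /andP[tt' _]; apply: contraTneq tt' => ->; rewrite path_edge_irr.
Qed.

Lemma inner_degree n (t : 'I_n.*2.+1) : (1 < n)%N ->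
  (#|[set t' | path_edge t t' & inner t' == inner t]| <= 1)%N.
Proof.
move=> n1.
(* The vertex i + 1 cannot agree with both neighbours. If i is odd, i + 1 is inner and i is not; if
   i is even, agreement forces i = 0 and i + 2 = 2n, against n > 1. *)
have alt i : (i.+2 < n.*2.+1)%N ->
    [&& (0 < i)%N, (i < n.*2)%N & ~~ odd i] = ((i.+1 < n.*2)%N && odd i) ->
    ((i.+2 < n.*2)%N && ~~ odd i) = ((i.+1 < n.*2)%N && odd i) -> False.
  move=> hi; have h1 : (i.+1 < n.*2)%N by [].
  rewrite h1 (ltnW h1); case: (odd i); rewrite ?andbF ?andbT //=.
  by case: i {hi h1} => // _; lia.
apply/card_le1_eqP => t1 t2; rewrite !inE => /andP[e1 /eqP s1] /andP[e2 /eqP s2].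
apply: val_inj; move: e1 e2 s1 s2; rewrite /path_edge /inner /=.
case: t t1 t2 => t tm [t1 t1m] [t2 t2m] /=.
case/orP => /eqP e1; case/orP => /eqP e2; subst => /=; rewrite ?negbK //.
- by move=> s1 s2; case: (alt t2).
- by move=> s1 s2; case: (alt t1).
- by case: e2.
Qed.

(** Common to both odd cases: (c, d) is (2, 2) for three vertices and ([beta R n], 1) for longer
    paths. *)
Lemma odd_pow_f (R : realType) n (c : R) d j : (0 < n)%N -> 0 < c ->
  (forall v, (forall t : 'I_n.*2.+1, ~~ odd t -> v t = 0) ->
    c * \sum_t v t ^+ 2 <= energy (@path_weight R n.*2.+1) v) ->
  (forall D : nat, c <= D%:R ^+ 2 -> (d <= D)%N) ->
  (forall t : 'I_n.*2.+1, #|[set t' | path_edge t t' & inner t' == inner t]| <= d)%N ->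
  f (cart_pow (path_graph n.*2.+1) j.+1) = d.
Proof.
move=> n0 c0 pb cd deg; rewrite /cart_pow /=; set G := iter j _ _.
have [S [cS dS]] : exists S : {set G}, #|S| = (alpha G).+1 /\ (max_degree (induced S) <= d)%N.
  by have := @exists_sparse_set R n c pb j d n0 c0 deg.
have [p [w og]] : exists p w, @odd_grid R c G p w by exact: (odd_grid_pow pb j).
have lb (T : {set G}) : #|T| = (alpha G).+1 -> (d <= max_degree (induced T))%N.
  move=> cT; apply: cd; apply: (odd_grid_max_degree og).
  by rewrite -(odd_grid_alpha c0 og) cT.
apply/eqP; rewrite eqn_leq (leq_trans (f_le cS) dS) /=; apply: f_ge => [|T /lb //].
exact: leq_trans (lb S cS) (max_degree_le_card S).
Qed.

Lemma even_pow_energy (R : realType) n j : (0 < n)%N ->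
  exists p w, @signing R (cart_pow (path_graph (2 * n)) j.+1) p w /\
    forall y, beta R n * j.+1%:R * \sum_u y u ^+ 2 <= energy w y.
Proof.
move=> n0; elim: j => [|j [p [w [sw lb]]]].
  exists (fun t : 'I__ => odd t), (@path_weight R _); split; first exact: path_signing.
  by move=> y; rewrite mulr1; exact: even_path_energy.
exists (@prod_parity _ _ p), (@prod_weight R _ _ w); split; first exact: prod_signing.
move=> y; rewrite -natr1 mulrDr mulr1.
exact: (prod_energy_ge sw lb (fun v => even_path_energy v n0)).
Qed.

Lemma even_pow_f_ge (R : realType) n j : (0 < n)%N ->
  beta R n * j.+1%:R <= (f (cart_pow (path_graph (2 * n)) j.+1))%:R ^+ 2.
Proof.
move=> n0; have [p [w [sw lb]]] := even_pow_energy R j n0.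
(* A vertex is needed so that the whole vertex set is strictly larger than one class, which gives
   the bound when [f] takes its default value. *)
have [u] : inhabited (cart_pow (path_graph (2 * n)) j.+1).
  have t : 'I_(2 * n) by apply: (@Ordinal _ 0); rewrite muln_gt0.
  by clear -t; elim: j => [|j [x]]; [exists | exists; exact: (x, t)].
have bnd (S : {set cart_pow (path_graph (2 * n)) j.+1}) b : (#|[set u | p u != b]| < #|S|)%N ->
    beta R n * j.+1%:R <= (max_degree (induced S))%:R ^+ 2.
  by apply: energy_bound_max_degree sw _ => y _; exact: lb.
case: (f_attained (cart_pow (path_graph (2 * n)) j.+1)) => [->|[S [cS ->]]].
  apply: le_trans (bnd [set: _] (p u) _) _.
    apply: proper_card.
    by apply/properP; split; [exact: finset.subsetT | exists u; rewrite !inE ?eqxx].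
  by rewrite lerXn2r ?nnegrE ?ler0n // ler_nat max_degree_le_card.
by apply: (bnd S true); rewrite cS ltnS (class_le_alpha true sw).
Qed.

Theorem theorem1p2 (R : realType) (k : nat) (hk : (1 <= k)%N) :
  [/\ f (cart_pow (path_graph 3) k) = 2%N,
      forall m : nat, odd m -> (5 <= m)%N ->
        f (cart_pow (path_graph m) k) = 1%N,
      forall n : nat, (1 <= n)%N ->
        is_min_pos_root (g R n) (beta R n) /\
        Num.ceil (Num.sqrt (beta R n * k%:R))
          <= (f (cart_pow (path_graph (2 * n)%N) k))%:Z
    & beta R 1 = 1].
Proof.
case: k hk => // j _; split.
- apply: (@odd_pow_f R 1 2) => // [v|D|t]; first exact: path3_energy.
    by rewrite -natrX ler_nat; case: D => [|[]].
  exact: path3_degree.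
- move=> m om m5.
  have mE : m = m./2.*2.+1 by rewrite -[LHS]odd_double_half om.
  have n1 : (1 < m./2)%N by move: m5; rewrite {1}mE; lia.
  have n0 := ltnW n1; have [[b0 _ _] _] := @beta_spec R _ n0.
  rewrite mE; apply: (@odd_pow_f R _ (beta R m./2)) => // [v|D|t].
  + exact: odd_path_energy.
  + by case: D => //; rewrite expr0n leNgt b0.
  + exact: inner_degree.
- move=> n n0; have [mb _] := @beta_spec R _ n0; split=> //.
  rewrite ceil_le_int -[leRHS]ger0_norm ?ler0z // -sqrtr_sqr.
  by rewrite ler_wsqrtr // even_pow_f_ge.
- exact: beta1.
Qed.
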